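(* Let $n\ge k\ge 1$ be integers and consider the $k$-nearest neighbor platoon $\mathcal{P}(n,k)$. For almost any choice of weights in the matrix $\mathcal{W}$ (i.e. for all choices outside a set of Lebesgue measure zero), the following holds: regardless of the actions of up to $\lfloor\frac{k-1}{2}\rfloor$ faulty vehicles, each vehicle $v_i$ can uniquely determine all of the initial values $x_1[0],\dots,x_n[0]$ in the network via the linear iterative strategy $\boldsymbol{x}[t+1]=\mathcal{W}\boldsymbol{x}[t]+\mathcal{A}\boldsymbol{\phi}[t]$.
   Context: The $k$-nearest neighbor platoon $\mathcal{P}(n,k)$ is the undirected simple graph on vertices $v_1,\dots,v_n$ (vehicles in a line, in this order) in which each vertex is adjacent to its $k$ nearest vertices in front and its $k$ nearest vertices behind (or all of those, when fewer than $k$ exist); that is, $v_i$ and $v_j$ are adjacent iff $1\le |i-j|\le k$. Let $\mathcal{N}_i$ be the set of neighbors of $v_i$ and $d_i=|\mathcal{N}_i|$. Linear iterative strategy: each vehicle $v_i$ holds a real scalar $x_i[t]$, $t=0,1,2,\dots$, updated by $$x_i[t+1]=w_{ii}x_i[t]+\sum_{j\in\mathcal{N}_i}w_{ij}x_j[t]+\phi_i[t],$$ where $w_{ii},w_{ij}>0$ (for $j\in\mathcal{N}_i$) are predefined weights. A vehicle is non-faulty if $\phi_i[t]=0$ for all $t$; a faulty vehicle may use an arbitrary real sequence $\phi_i[t]$. In vector form, if the faulty vehicles form a set $F=\{i_1,\dots,i_f\}$, then $\boldsymbol{x}[t+1]=\mathcal{W}\boldsymbol{x}[t]+\mathcal{A}\boldsymbol{\phi}[t]$,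 where $\boldsymbol{x}=(x_1,\dots,x_n)^{\mathsf T}$; $\mathcal{W}\in\mathbb{R}^{n\times n}$ is the matrix of weights (its $(i,j)$ entry is $w_{ij}$ if $j=i$ or $j\in\mathcal{N}_i$, and $0$ otherwise); $\mathcal{A}=[\mathbf{e}_{i_1}\ \cdots\ \mathbf{e}_{i_f}]$ with $\mathbf{e}_i$ the $i$-th standard unit vector of $\mathbb{R}^n$; and $\boldsymbol{\phi}[t]=(\phi_{i_1}[t],\dots,\phi_{i_f}[t])^{\mathsf T}$. ''Almost any choice of weights'' refers to Lebesgue measure on the space of the free parameters $w_{ii},w_{ij}$. At each time $t$ vehicle $v_i$ measures $y_i[t]=\mathcal{C}_i\boldsymbol{x}[t]$, where $\mathcal{C}_i$ is the $(d_i+1)\times n$ matrix with a single $1$ in each row selecting the states of $v_i$ and its neighbors. The set $F$ (hence $\mathcal{A}$) and the inputs $\boldsymbol{\phi}$ are unknown to the vehicles; each vehicle knows only $\mathcal{W}$ and an upper bound on the number of faulty vehicles (here $\lfloor\frac{k-1}{2}\rfloor$). ''$v_i$ can uniquely determine all of the initial values'' means that the measurement sequence $(y_i[t])_{t\ge 0}$ determines $\boldsymbol{x}[0]$: whenever two triples $(\boldsymbol{x}[0],F,\boldsymbol{\phi})$ and $(\boldsymbol{x}'[0],F',\boldsymbol{\phi}')$ with $|F|,|F'|\le\lfloor\frac{k-1}{2}\rfloor$ produce the same measurements $y_i[t]$ for all $t\ge0$, then $\boldsymbol{x}[0]=\boldsymbol{x}'[0]$. *)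

(* Defs.v *)
From HB Require Import structures.
From mathcomp Require Import all_boot all_order all_algebra.
From mathcomp Require Import all_classical all_reals all_analysis.

Set Implicit Arguments.
Unset Strict Implicit.
Unset Printing Implicit Defensive.
Import Order.TTheory GRing.Theory Num.Theory.
Local Open Scope classical_set_scope.
Local Open Scope ring_scope.

Section LebesgueTuple.
Context {R : realType}.
Local Notation mR := (measurableTypeR R).

Definition cons_pair n (p : mR * n.-tuple mR) : n.+1.-tuple mR :=
  [the n.+1.-tuple mR of p.1 :: p.2].

(* Lebesgue measure on R^n, by transporting the product of the one-dimensional
   Lebesgue measure and the Lebesgue measure on R^(n-1) along the identification
   R * R^(n-1) = R^n. *)
Fixpoint lebesgue_tuple n : set (n.-tuple mR) -> \bar R :=
  if n is m.+1 then
    pushforward (@lebesgue_measure R \x lebesgue_tuple (n := m))%E (@cons_pair m)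
  else dirac [tuple].

Lemma measurable_cons_pair n : measurable_fun setT (@cons_pair n).
Proof. exact: measurable_cons. Qed.

Definition box n (A : 'I_n -> set mR) : set (n.-tuple mR) :=
  [set t | forall i, A i (tnth t i)].

Lemma cons_pair_preimage_box n (A : 'I_n.+1 -> set mR) :
  @cons_pair n @^-1` box A = A ord0 `*` box (fun i => A (lift ord0 i)).
Proof.
apply/seteqP; split=> -[x t] /=.
  move=> At; split=> [|i /=]; first exact: (At ord0).
  by have := At (lift ord0 i); rewrite tnthS.
move=> [A0 At] i; case: (unliftP ord0 i) => [j|] ->; last exact: A0.
by rewrite tnthS; exact: At.
Qed.

Lemma measurable_box n (A : 'I_n -> set mR) :
  (forall i, measurable (A i)) -> measurable (box A).
Proof.
move=> mA.
have -> : box A =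
    \bigcap_(i in [set: 'I_n]) ((fun t => @tnth n mR t i) @^-1` A i).
  by apply/seteqP; split=> t /= H i; [move=> _; exact: H|exact: (H i I)].
apply: fin_bigcap_measurable => // i _; rewrite -[X in measurable X]setTI.
exact: measurable_tnth.
Qed.

Definition product_on_boxes n (m : set (n.-tuple mR) -> \bar R) : Prop :=
  forall A : 'I_n -> set mR, (forall i, measurable (A i)) ->
    m (box A) = (\prod_(i < n) lebesgue_measure (A i))%E.

Lemma sigma_finite_product_on_boxes n (m : set (n.-tuple mR) -> \bar R) :
  product_on_boxes m -> sigma_finite setT m.
Proof.
move=> mE; exists (fun j => box (fun _ => [set` `[- (j%:R : R), j%:R]%R])).
  apply/seteqP; split=> // t _.
  exists (Num.truncn (\sum_i `|tnth t i|)).+1 => // i /=.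
  rewrite in_itv /= -ler_norml ltW// (le_lt_trans _ (truncnS_gt _))//.
  by rewrite (bigD1 i)//= lerDl sumr_ge0.
move=> j; split; first by apply: measurable_box => i; exact: measurable_itv.
rewrite mE => [|i]; last exact: measurable_itv.
set l := BIG_F.
suff [] : (\prod_(i < n) l i < +oo /\ 0 <= \prod_(i < n) l i)%E by [].
apply: (big_ind (fun x : \bar R => (x < +oo)%E /\ (0 <= x)%E)).
- by rewrite ltry lee01.
- move=> x y [xoo x0] [yoo y0].
  by rewrite lte_mul_pinfty ?mule_ge0// ge0_fin_numE.
- move=> i _; rewrite /l measure_ge0 lebesgue_measure_itv/=.
  by case: ifP => _; rewrite ?ltry// -EFinB ltry.
Qed.

Lemma lebesgue_tuple_ex n :
  exists m : {sigma_finite_measure set (n.-tuple mR) -> \bar R},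
  lebesgue_tuple (n := n) = m /\ product_on_boxes m.
Proof.
elim: n => [|n [m [mE mbox]]].
  exists (@dirac _ _ [tuple] R); split => // A _.
  by rewrite big_ord0 /= diracE mem_set// => -[].
pose p := pushforward (@lebesgue_measure R \x m)%E (@cons_pair n).
have pE : lebesgue_tuple (n := n.+1) = p by rewrite /= mE.
have pbox : product_on_boxes p.
  move=> A mA; rewrite /p /pushforward cons_pair_preimage_box.
  rewrite product_measure1E//; last by apply: measurable_box.
  by rewrite big_ord_recl mbox.
pose p' : {measure set (n.+1.-tuple mR) -> \bar R} :=
  measure_function_pushforward__canonical__measure_function_Measure
    (@lebesgue_measure R \x m)%E (@measurable_cons_pair n).
pose sf := isSigmaFinite.Build _ _ _ p (sigma_finite_product_on_boxes pbox).
pose sfin := isSFinite.Build _ _ _ p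
  (sfinite_measure_sigma_finite (mu := p') (sigma_finite_product_on_boxes pbox)).
exists (HB.pack_for (sigma_finite_measure (n.+1.-tuple mR) R)
  (Measure.sort p') sf sfin).
by rewrite pE.
Qed.

Lemma lebesgue_tuple_box n : product_on_boxes (lebesgue_tuple (n := n)).
Proof. by have [m [-> ]] := lebesgue_tuple_ex n. Qed.

Section instances.
Variable n : nat.
Local Notation mu := (lebesgue_tuple (n := n)).

Let lebesgue_tuple0 : mu set0 = 0%E.
Proof. by have [m [-> _]] := lebesgue_tuple_ex n. Qed.

Let lebesgue_tuple_ge0 A : (0 <= mu A)%E.
Proof. by have [m [-> _]] := lebesgue_tuple_ex n. Qed.

Let lebesgue_tuple_sigma_additive : semi_sigma_additive mu.
Proof.
by have [m [-> _]] := lebesgue_tuple_ex n; exact: measure_semi_sigma_additive.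
Qed.

HB.instance Definition _ := isMeasure.Build _ _ _ mu
  lebesgue_tuple0 lebesgue_tuple_ge0 lebesgue_tuple_sigma_additive.

HB.instance Definition _ := Measure_isSigmaFinite.Build _ _ _ mu
  (sigma_finite_product_on_boxes (@lebesgue_tuple_box n)).

End instances.
End LebesgueTuple.

Arguments lebesgue_tuple {R} n A : simpl nomatch.

Definition platoon_adj (n k : nat) : rel 'I_n :=
  fun i j => (1 <= `|(i : nat)%:Z - (j : nat)%:Z| <= k)%N.

Definition neighbors (n k : nat) (i : 'I_n) : {set 'I_n} :=
  [set j | platoon_adj k i j].

(* Index set of the free weights; the weights w_ij and w_ji of an edge are
   independent parameters. *)
Definition weight_index (n k : nat) :=
  {e : 'I_n * 'I_n | (e.1 == e.2) || (e.2 \in neighbors k e.1)}.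

(* The space of free parameters is R^N with N = #|weight_index n k|; the
   coordinate with number enum_rank e is the weight of index e. *)
Definition weight (R : realType) (n k : nat)
    (w : #|{: weight_index n k}|.-tuple R) (e : weight_index n k) : R :=
  tnth w (enum_rank e).

Definition weight_mx (R : realType) (n k : nat)
    (w : #|{: weight_index n k}|.-tuple R) : 'M[R]_n :=
  \matrix_(i, j) oapp (weight w) 0 (insub (i, j)).

Definition input_mx (R : realType) (n : nat) (F : {set 'I_n}) :
    'M[R]_(n, #|F|) :=
  colsub (@enum_val _ (mem F)) 1%:M.

Definition output_mx (R : realType) (n k : nat) (i : 'I_n) :
    'M[R]_(1 + #|neighbors k i|, n) :=
  col_mx (row i 1%:M) (rowsub (@enum_val _ (mem (neighbors k i))) 1%:M).

Fixpoint state (R : realType) (n : nat) (W : 'M[R]_n) (x0 : 'cV[R]_n)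
    (F : {set 'I_n}) (phi : nat -> 'cV[R]_#|F|) (t : nat) : 'cV[R]_n :=
  if t is s.+1 then W *m state W x0 phi s + input_mx R F *m phi s else x0.

(* The faulty set and its inputs are unknown, so they may differ between the
   two scenarios that are compared; the weight matrix W is known. *)
Definition determines_initial_values (R : realType) (n m : nat) (W : 'M[R]_n)
    (C : 'M[R]_(m, n)) (f : nat) : Prop :=
  forall (x0 x0' : 'cV[R]_n) (F F' : {set 'I_n})
         (phi : nat -> 'cV[R]_#|F|) (phi' : nat -> 'cV[R]_#|F'|),
    (#|F| <= f)%N -> (#|F'| <= f)%N ->
    (forall t, C *m state W x0 phi t = C *m state W x0' phi' t) ->
    x0 = x0'.

(* Main.v *)
Require Import Defs.
From mathcomp Require Import all_boot all_order all_algebra.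
From mathcomp Require Import complex zify.
From mathcomp Require Import all_classical all_reals all_analysis.
Set Implicit Arguments.
Unset Strict Implicit.
Unset Printing Implicit Defensive.
Import Order.TTheory GRing.Theory Num.Theory.
Local Open Scope ring_scope.

(** For almost every choice of weights, the weights are algebraically
independent over the rationals ([ae_alg_independent]): there are countably many
rational polynomials, and the zero set of a nonzero one is null.  The theorem
holds for every such choice, by a count of dimensions.

Suppose that two scenarios with the same measurements at [v_i] start from
different states, and let [z] be the difference of the two trajectories.  It
vanishes forever on [v_i] and its neighbors, and follows [z(t+1) = W z(t)] at
every vertex outside the union [G] of the two faulty sets, which has at most
[k - 1] elements.  The span of all the [z(t)] is finite-dimensional, and it is
mapped to itself by [W] up to errors supported on [G]; over the complex numbers
this gives a nonzero vector [v] that vanishes around [v_i] and satisfies the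
eigenvalue equation [(W v)_j = lambda v_j] at every [j] outside [G]
([invariant_direction]).

Let [T] be the support of [v].  The vertices [j] outside [G] that lie in [T] or
have a neighbor in [T] each give a nontrivial linear equation on row [j] of
[W], so that one weight of this row is a rational function of [lambda], of [v]
and of the other weights.  After normalizing [v], the weights thus depend
rationally on fewer than [N] quantities, where [N] is the number of weights, as
soon as there are more such vertices than elements of [T]
([eigen_alg_dependent]).  And there are more: the vertex of [T] closest to
[v_i] on one side has [k] neighbors between [v_i] and itself, all outside [T]
([card_boundary]), and [G] removes at most [k - 1] vertices.  So the weights
would be algebraically dependent ([alg_dependent_rational]). *)

(** * Algebraic dependence by dimension count *)

Definition monomial (K : comNzRingType) n (y : 'I_n -> K) D
    (a : n.-tuple 'I_D) : K :=
  \prod_(i < n) y i ^+ tnth a i.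

(** Rational coefficients make the set of possible relations countable. *)
Definition alg_dependent (K : numFieldType) n (y : 'I_n -> K) : Prop :=
  exists D (c : {ffun n.-tuple 'I_D -> rat}),
    c != 0 /\ \sum_a ratr (c a) * monomial y a = 0.

(** [x] is a rational polynomial in the entries of [t], of degree less than [m]
in each of them.  Nesting univariate polynomials, rather than summing over
monomials, reduces closure under products to the formula for the coefficients
of a product. *)
Fixpoint poly_in (K : numFieldType) (t : seq K) (m : nat) (x : K) : Prop :=
  if t is s :: t' then
    exists p : {poly K},
      [/\ (size p <= m)%N, forall b, poly_in t' m p`_b & x = p.[s]]
  else exists q, x = ratr q.

Section PolyIn.
Variable K : numFieldType.
Implicit Types (t : seq K) (x y : K).

Lemma poly_in0 t m : poly_in t m 0.
Proof.
elim: t => [|s t IH] /=; first by exists 0; rewrite rmorph0.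
by exists 0; split=> [|b|]; rewrite ?size_poly0 ?coef0 ?horner0.
Qed.

Lemma poly_in_add t m x y : 
  poly_in t m x -> poly_in t m y -> poly_in t m (x + y).
Proof.
elim: t x y => [|s t IH] x y /= => [[q ->] [r ->]|].
  by exists (q + r); rewrite rmorphD.
move=> [p [sp cp ->]] [q [sq cq ->]]; exists (p + q); split=> [|b|].
- by rewrite (leq_trans (size_polyD _ _))// geq_max sp.
- by rewrite coefD; exact: IH.
- by rewrite hornerD.
Qed.

Lemma poly_in_opp t m x : poly_in t m x -> poly_in t m (- x).
Proof.
elim: t x => [|s t IH] x /= => [[q ->]|[p [sp cp ->]]].
  by exists (- q); rewrite rmorphN.
exists (- p); split=> [|b|]; rewrite ?size_polyN ?hornerN//.
by rewrite coefN; exact: IH.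
Qed.

Lemma poly_in_sum t m (I : Type) (r : seq I) (P : pred I) (f : I -> K) :
  (forall i, P i -> poly_in t m (f i)) -> poly_in t m (\sum_(i <- r | P i) f i).
Proof.
move=> fP; elim/big_ind: _ => //; first exact: poly_in0.
by move=> x y; exact: poly_in_add.
Qed.

Lemma poly_in_mul t m1 m2 x y :
  poly_in t m1 x -> poly_in t m2 y -> poly_in t (m1 + m2) (x * y).
Proof.
elim: t x y => [|s t IH] x y /= => [[q ->] [r ->]|].
  by exists (q * r); rewrite rmorphM.
move=> [p [sp cp ->]] [q [sq cq ->]]; exists (p * q); split=> [|b|].
- rewrite (leq_trans (size_polyMleq _ _))// (leq_trans (leq_pred _))//.
  exact: leq_add.
- by rewrite coefM; apply: poly_in_sum => i _; exact: IH.
- by rewrite hornerM.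
Qed.

Lemma poly_in_leq t m1 m2 x : (m1 <= m2)%N -> poly_in t m1 x -> poly_in t m2 x.
Proof.
move=> m12; elim: t x => //= s t IH x [p [sp cp ->]].
by exists p; split=> // [|b]; [exact: leq_trans m12|exact: IH].
Qed.

Lemma poly_in_ratr t m q : (0 < m)%N -> poly_in t m (ratr q).
Proof.
move=> m0; elim: t => [|s t IH] /=; first by exists q.
exists (ratr q)%:P; split=> [|b|]; rewrite ?hornerC//.
  by rewrite (leq_trans (size_polyC_leq1 _)).
by rewrite coefC; case: eqP => _; [exact: IH|exact: poly_in0].
Qed.

Lemma poly_in1 t m : (0 < m)%N -> poly_in t m 1.
Proof. by rewrite -[1](ratr_nat K 1); exact: poly_in_ratr. Qed.

Lemma poly_in_mem t m x : (1 < m)%N -> x \in t -> poly_in t m x.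
Proof.
move=> m1; elim: t => //= s t IH; rewrite inE => /predU1P[->|/IH xt].
  exists 'X; split=> [|b|]; rewrite ?size_polyX ?hornerX// coefX.
  by rewrite -(@ratr_nat K); apply: poly_in_ratr; exact: ltnW.
exists x%:P; split=> [|b|]; rewrite ?hornerC//.
  by rewrite (leq_trans (size_polyC_leq1 _))// ltnW.
by rewrite coefC; case: eqP => _; [exact: xt|exact: poly_in0].
Qed.

Lemma poly_in_prod t m (I : Type) (r : seq I) (f : I -> K) :
  (forall i, poly_in t m (f i)) ->
  poly_in t (size r * m).+1 (\prod_(i <- r) f i).
Proof.
move=> fP; rewrite -addn1; elim: r => [|i r IH].
  by rewrite big_nil; exact: poly_in1.
by rewrite big_cons/= mulSn -addnA; exact: poly_in_mul.
Qed.

Lemma poly_in_exp t m x j : poly_in t m x -> poly_in t (j * m).+1 (x ^+ j).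
Proof.
move=> xt; rewrite -addn1; elim: j => [|j IH].
  by exact: poly_in1.
by rewrite exprS mulSn -addnA; exact: poly_in_mul.
Qed.

(** A polynomial of degree less than [m] in each of [size t] variables has
[m ^ size t] coefficients. *)
Lemma poly_in_spanned t m : exists (I : finType) (e : I -> K),
  #|I| = (m ^ size t)%N /\
  forall x, poly_in t m x -> exists c : I -> rat, x = \sum_i ratr (c i) * e i.
Proof.
elim: t => [|s t [I [e [cardI eI]]]] /=.
  exists unit, (fun=> 1); split=> [|x [q ->]]; first by rewrite card_unit.
  by exists (fun=> q); rewrite big_const card_unit/= addr0 mulr1.
exists ('I_m * I)%type, (fun bi : 'I_m * I => e bi.2 * s ^+ bi.1).
split=> [|x [p [sp cp ->]]].
  by rewrite card_prod card_ord cardI expnS.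
have /choice[c cE] b := eI _ (cp b).
exists (fun bi : 'I_m * I => c bi.1 bi.2); rewrite (horner_coef_wide _ sp).
rewrite -(pair_bigA _ (fun (b : 'I_m) i => ratr (c b i) * (e i * s ^+ b)))/=.
by apply: eq_bigr => b _; rewrite cE mulr_suml; apply: eq_bigr => i _;
  rewrite mulrA.
Qed.

Lemma rat_dependent (I J : finType) (e : I -> K) (x : J -> K) :
  (forall j, exists c : I -> rat, x j = \sum_i ratr (c i) * e i) ->
  (#|I| < #|J|)%N ->
  exists c : {ffun J -> rat}, c != 0 /\ \sum_j ratr (c j) * x j = 0.
Proof.
move=> /choice[A AE] IJ.
pose M : 'M[rat]_(#|J|, #|I|) := \matrix_(j, i) A (enum_val j) (enum_val i).
have : kermx M != 0.
  rewrite -mxrank_eq0 mxrank_ker subn_eq0 -ltnNge.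
  by rewrite (leq_ltn_trans (rank_leq_col _)).
move=> /rowV0Pn[v /sub_kermxP vM v0].
exists [ffun j => v ord0 (enum_rank j)]; split.
  apply: contra v0 => /eqP/ffunP v0; apply/eqP/rowP => j.
  by have := v0 (enum_val j); rewrite !ffunE enum_valK mxE.
under eq_bigr => j _ do rewrite ffunE AE mulr_sumr.
rewrite exchange_big/= big1// => i _.
under eq_bigr => j _ do rewrite mulrA.
have vMi : \sum_j v ord0 (enum_rank j) * A j i = 0.
  have /rowP/(_ (enum_rank i)) := vM; rewrite !mxE => vM0; rewrite -[RHS]vM0.
  rewrite [RHS](reindex _ (onW_bij _ (enum_rank_bij J)))/=.
  by apply: eq_bigr => j _; rewrite mxE !enum_rankK.
rewrite -mulr_suml -[RHS](mul0r (e i)) -[in RHS](rmorph0 (@ratr K)).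
rewrite -[in RHS]vMi rmorph_sum/=.
by congr (_ * _); apply: eq_bigr => j _; rewrite rmorphM.
Qed.

(** More than [size t] rational functions of [t] satisfy a polynomial relation.
Here [h] is a common denominator.  The monomials of degree less than [D] in each
of the [n] functions, multiplied by [h ^+ (n * D)], are [D ^ n] polynomials in
[t] of degree O(D), hence lie in a space of dimension O(D ^ size t), which is
smaller than [D ^ n] for large [D]. *)
Lemma alg_dependent_rational n (y : 'I_n -> K) t h : (size t < n)%N -> h != 0 ->
  (exists m, poly_in t m h) -> (forall i, exists m, poly_in t m (h * y i)) ->
  alg_dependent y.
Proof.
move=> tn h0 [mh hin] /choice[my yin].
pose d := (mh + \sum_i my i)%N.
have {}hin : poly_in t d h by apply: poly_in_leq hin; exact: leq_addr.
have {}yin i : poly_in t d (h * y i).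
  apply: poly_in_leq (yin i); rewrite /d (bigD1 i)//= addnCA; exact: leq_addr.
pose B := (n * (d + d + 2) + 1)%N.
(* [(B * D) ^ size t < D ^ (size t).+1] as soon as [B ^ size t < D] *)
pose D := (B ^ size t).+1.
have Y (a : n.-tuple 'I_D) : poly_in t (B * D) (h ^+ (n * D) * monomial y a).
  have -> : h ^+ (n * D) * monomial y a =
      \prod_(i < n) ((h * y i) ^+ tnth a i * h ^+ (D - tnth a i)).
    have -> : h ^+ (n * D) = \prod_(i < n) h ^+ D.
      by rewrite prodr_const card_ord mulnC exprM.
    rewrite -big_split/=.
    apply: eq_bigr => i _; rewrite exprMn mulrAC -exprD subnKC//.
    exact: ltnW.
  apply: (@poly_in_leq _
    (size (index_enum 'I_n) * ((D * d).+1 + (D * d).+1)).+1); last first.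
    apply: poly_in_prod => i; apply: poly_in_mul.
      apply: poly_in_leq (poly_in_exp _ (yin i)).
      by rewrite ltnS leq_mul2r ltnW ?orbT.
    apply: poly_in_leq (poly_in_exp _ hin).
    by rewrite ltnS leq_mul2r leq_subr orbT.
  rewrite /index_enum -enumT size_enum_ord /B mulnDl mul1n -addn1 leq_add//.
  rewrite -mulnA leq_mul2l.
  apply/orP; right; rewrite [(D * d)%N]mulnC !mulnDl addSn addnS -addn2.
  by rewrite leq_add2l leq_pmulr.
have [I [e [cardI eI]]] := poly_in_spanned t (B * D).
have [] := @rat_dependent I {: n.-tuple 'I_D} e
    (fun a => h ^+ (n * D) * monomial y a).
- by move=> a; apply: eI; exact: Y.
- rewrite cardI card_tuple card_ord expnMn.
  rewrite (@leq_trans (D ^ (size t).+1))//; last by rewrite leq_pexp2l.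
  by rewrite expnS ltn_mul2r expn_gt0/= /D ltnS leqnn.
move=> c [c0 cE]; exists D, c; split=> //.
apply: (mulfI (expf_neq0 (n * D) h0)); rewrite mulr0 -[RHS]cE mulr_sumr.
by apply: eq_bigr => a _; rewrite mulrCA.
Qed.

End PolyIn.

Lemma alg_dependent_rmorph (K L : numFieldType) (f : {rmorphism K -> L}) n
    (y : 'I_n -> K) : alg_dependent (f \o y) -> alg_dependent y.
Proof.
move=> [D [c [c0 cy]]]; exists D, c; split=> //.
apply: (fmorph_inj f); rewrite rmorph0 -[RHS]cy rmorph_sum/=.
apply: eq_bigr => a _; rewrite rmorphM fmorph_rat rmorph_prod; congr (_ * _).
by apply: eq_bigr => i _; rewrite rmorphXn.
Qed.

(** * Almost every point is algebraically independent *)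

Lemma finite_set_root (R : idomainType) (q : {poly R}) :
  q != 0 -> finite_set [set x | root q x]%classic.
Proof.
have [s] := ubnP (size q); elim: s q => // s IH q qs q0.
have [[x qx]|noroot] := pselect (exists x, root q x); last first.
  apply: (@sub_finite_set _ _ set0) => // x qx.
  by exfalso; apply: noroot; exists x.
have [r qE] := factor_theorem q x qx; subst q.
have r0 : r != 0 by move: q0; rewrite mulf_eq0 negb_or => /andP[].
apply: (@sub_finite_set _ _ ([set x] `|` [set x | root r x])%classic) => [y|].
  by rewrite /= rootM root_XsubC => /orP[|/eqP]; [right|left].
rewrite finite_setU; split; first exact: finite_set1.
apply: IH => //; move: qs.
by rewrite size_Mmonic ?monicXsubC// size_XsubC addn2.
Qed.

Section ZeroSet.
Local Open Scope classical_set_scope.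
Variable R : realType.
Local Notation mR := (measurableTypeR R).

Lemma measurable_zero_set n D (c : {ffun n.-tuple 'I_D -> R}) :
  measurable [set w : n.-tuple mR | \sum_a c a * monomial (tnth w) a = 0 :> R].
Proof.
have mf : measurable_fun [set: n.-tuple mR]
    (fun w => \sum_a c a * monomial (tnth w) a : R).
  apply: measurable_sum => a; apply: measurable_realfun.measurable_funM => //.
  apply: measurable_prod => i _; apply: measurable_realfun.measurable_funX.
  exact: measurable_tnth.
rewrite -[X in measurable X]setTI.
exact: (mf measurableT [set 0] (measurable_set1 _)).
Qed.

(** Fubini and induction on the number of variables: some coefficient of the
polynomial, as a polynomial in the last [n] variables, is a nonzero polynomial
[q0] in the first variable, so that it vanishes for finitely many values of
that variable only; for every other value, the section is a zero set in [n]
variables. *)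
Lemma lebesgue_zero_set n D (c : {ffun n.-tuple 'I_D -> R}) : c != 0 ->
  lebesgue_tuple n
    [set w : n.-tuple mR | \sum_a c a * monomial (tnth w) a = 0 :> R] = 0%E.
Proof.
elim: n c => [|n IH] c /eqP c0.
  rewrite /= diracE memNset// => /=.
  rewrite (big_pred1 [tuple]) => [|a]; last by apply/esym/eqP/tuple0.
  rewrite /monomial big_ord0 mulr1 => ctuple; apply: c0; apply/ffunP => a.
  by rewrite (tuple0 a) ctuple ffunE.
set A := [set w | _].
have [a ca] : exists a, c a != 0.
  apply: contrapT => ca; apply: c0; apply/ffunP => a; rewrite ffunE.
  by apply/eqP/negPn/negP => ?; apply: ca; exists a.
(* coefficient of the monomial [a'] in the last [n] variables *)
pose q (a' : n.-tuple 'I_D) : {poly R} := \poly_(b < D)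
  oapp (fun b' => c (cons_tuple b' a')) 0 (insub b).
have qb a' (b : 'I_D) : (q a')`_b = c (cons_tuple b a').
  by rewrite coef_poly ltn_ord valK.
pose C x : {ffun n.-tuple 'I_D -> R} := [ffun a' => (q a').[x]].
have cons_eval x w : \sum_a c a * monomial (tnth (@cons_pair R n (x, w))) a =
    \sum_a' C x a' * monomial (tnth w) a'.
  pose h (ba : 'I_D * n.-tuple 'I_D) : n.+1.-tuple 'I_D := cons_tuple ba.1 ba.2.
  have h_bij : bijective h.
    exists (fun a => (thead a, behead_tuple a)) => [[b a']|a'].
      by rewrite theadE; congr pair; apply/val_inj.
    by apply/val_inj; rewrite [in RHS](tuple_eta a').
  rewrite (reindex h) /=; last exact: onW_bij.
  rewrite -(pair_bigA _ (fun b a' =>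
    c (h (b, a')) * monomial (tnth (cons_pair (x, w))) (h (b, a'))))/=.
  rewrite exchange_big/=; apply: eq_bigr => a' _; rewrite ffunE.
  rewrite horner_poly mulr_suml; apply: eq_bigr => b _.
  rewrite valK/= -mulrA; congr (_ * _).
  rewrite /monomial big_ord_recl; congr (_ * _).
  by apply: eq_bigr => i _; rewrite !tnthS.
pose q0 := q (behead_tuple a).
have q0_neq0 : q0 != 0.
  apply: contra ca => /eqP q00; have := qb (behead_tuple a) (thead a).
  rewrite -/q0 q00 coef0 => ch; apply/eqP; rewrite [RHS]ch; congr (c _).
  by apply/val_inj; rewrite [in LHS](tuple_eta a).
rewrite /= /pushforward.
set B := _ @^-1` A.
have mB : measurable B.
  rewrite -[X in measurable X]setTI; apply: measurable_cons_pair => //.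
  exact: measurable_zero_set.
rewrite /product_measure1 (@ge0_ae_eq_integral _ _ _ _ _ _ (cst 0%E)) //.
- exact: integral0.
- exact: measurable_fun_xsection.
- exists [set x | root q0 x]; split.
  + apply: countable_measurable => [t|]; [exact: measurable_set1|].
    by apply: finite_set_countable; exact: finite_set_root q0_neq0.
  + apply: countable_lebesgue_measure0.
    by apply: finite_set_countable; exact: finite_set_root q0_neq0.
  + move=> x /=; apply: contra_notP => /negP qx _ /=.
    rewrite -[RHS](IH (C x)); last first.
      apply: contra qx => /eqP/ffunP/(_ (behead_tuple a)).
      by rewrite !ffunE => /eqP.
    congr (lebesgue_tuple n _); apply/seteqP; split => w;
      by rewrite /xsection /= inE /B /A /= cons_eval.
Qed.

Lemma ae_alg_independent n :
  {ae lebesgue_tuple n, forall w : n.-tuple mR,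
    ~ alg_dependent (fun i => tnth w i : R)}.
Proof.
pose Z (Dc : {D : nat & {ffun n.-tuple 'I_D -> rat}}) :=
  [set w : n.-tuple mR | tagged Dc != 0 /\
    \sum_a ratr (tagged Dc a) * monomial (tnth w) a = 0 :> R].
pose F m := oapp Z set0 (unpickle m).
apply: (@negligibleS _ _ _ _ (\bigcup_m F m)).
  move=> w /= /contrapT[D [c [c0 cw]]].
  exists (pickle (Tagged (fun D => {ffun n.-tuple 'I_D -> rat}) c)) => //.
  by rewrite /F pickleK.
apply: negligible_bigcup => m; rewrite /F.
case: unpickle => [[D c]|]; last first.
  exact: negligible_set0.
rewrite /Z/=; have [->|c0] := eqVneq c 0.
  by apply: (negligibleS _ (negligible_set0 _)) => w [/eqP].
exists [set w : n.-tuple mR |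
  \sum_a [ffun a => ratr (c a)] a * monomial (tnth w) a = 0 :> R]; split.
- exact: measurable_zero_set.
- apply: lebesgue_zero_set; apply: contra c0 => /eqP/ffunP c0.
  apply/eqP/ffunP => a; have := c0 a; rewrite !ffunE => /eqP.
  by rewrite fmorph_eq0 => /eqP.
- by move=> w [_ wE] /=; rewrite -[RHS]wE; apply: eq_bigr => a _; rewrite ffunE.
Qed.
End ZeroSet.

(** * From a shared measurement sequence to an eigenvector *)

Lemma output_mx_eq (R : realType) n k (i : 'I_n) (x x' : 'cV[R]_n) j :
  output_mx R k i *m x = output_mx R k i *m x' ->
  j \in i |: neighbors k i -> x j 0 = x' j 0.
Proof.
rewrite /output_mx !mul_col_mx => /eq_col_mx[xi xN].
rewrite in_setU1 => /predU1P[->|jN].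
  by move: xi; rewrite -!row_mul !mul1mx => /rowP/(_ 0); rewrite !mxE.
have /colP/(_ (enum_rank_in jN j)) := xN.
by rewrite !mul_rowsub_mx !mul1mx !mxE enum_rankK_in.
Qed.

Lemma state_nonfaulty (R : realType) n (W : 'M[R]_n) x0 (F : {set 'I_n})
    (phi : nat -> 'cV[R]_#|F|) t j : j \notin F ->
  state W x0 phi t.+1 j 0 = (W *m state W x0 phi t) j 0.
Proof.
move=> jF; rewrite /= mxE [X in _ + X]mxE [X in _ + X]big1 ?addr0// => a _.
rewrite !mxE (_ : (j == _) = false) ?mul0r//.
by apply: contraNF jF => /eqP ->; exact: enum_valP.
Qed.

(** The rows of [Z T] are the first [T] states, and those of [Z' T] their
successors.  When the rank of [Z T] stops
growing at some [T], the time shift maps the row space of [Z T] to itself.  In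
a basis [V] of this space the shift is a square matrix [B], and an eigenvector
[u] of [B] gives the vector [u *m V]. *)
Lemma invariant_direction (R : rcfType) n (W : 'M[R]_n) (z : nat -> 'cV[R]_n)
    (S G : {set 'I_n}) :
  z 0%N != 0 ->
  (forall t j, j \in S -> z t j 0 = 0) ->
  (forall t j, j \notin G -> z t.+1 j 0 = (W *m z t) j 0) ->
  exists (lambda : R[i]) (v : 'rV[R[i]]_n),
    [/\ v != 0, forall j, j \in S -> v 0 j = 0 &
      forall j, j \notin G ->
        \sum_l real_complex R (W j l) * v 0 l = lambda * v 0 j].
Proof.
move=> z0 zS zG.
pose Z T := \matrix_(s < T, l < n) z s l 0.
pose Z' T := \matrix_(s < T, l < n) z s.+1 l 0.
have sub_Z s T : (s < T)%N -> ((z s)^T <= Z T)%MS.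
  move=> sT; suff -> : (z s)^T = row (Ordinal sT) (Z T) by exact: row_sub.
  by apply/rowP => l; rewrite !mxE.
have Z_mono T : (Z T <= Z T.+1)%MS.
  apply/row_subP => s; suff -> : row s (Z T) = (z s)^T.
    exact: (@sub_Z s T.+1 (ltnW (ltn_ord s))).
  by apply/rowP => l; rewrite !mxE.
have [T T0 ZT] : exists2 T, (0 < T)%N & (Z T.+1 <= Z T)%MS.
  apply: contrapT => noT.
  suff rk T : (T <= \rank (Z T.+1))%N.
    by have := leq_trans (rk n.+1) (rank_leq_col _); rewrite ltnn.
  elim: T => // T IH; apply: leq_ltn_trans IH _.
  rewrite ltnNge; apply/negP => ZT; apply: noT; exists T.+1 => //.
  by rewrite (geq_leqif (mxrank_leqif_sup (Z_mono _))) in ZT.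
have Z'Z : (Z' T <= row_base (Z T))%MS.
  rewrite eq_row_base; apply: submx_trans ZT; apply/row_subP => s.
  suff -> : row s (Z' T) = (z s.+1)^T by exact: (@sub_Z s.+1 T.+1 (ltn_ord s)).
  by apply/rowP => l; rewrite !mxE.
have rZ : (0 < \rank (Z T))%N.
  rewrite lt0n mxrank_eq0; apply: contra z0 => /eqP ZT0.
  have /submxP[D] := sub_Z _ _ T0; rewrite ZT0 mulmx0 => z0.
  by rewrite -[z 0%N]trmxK z0 trmx0.
have /submxP[K VE] : (row_base (Z T) <= Z T)%MS by rewrite eq_row_base.
have /submxP[B BE] : (K *m Z' T <= row_base (Z T))%MS.
  exact: submx_trans (submxMl _ _) Z'Z.
have V_free := row_base_free (Z T).
set V := row_base (Z T) in VE BE V_free; clearbody V.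
pose f : {rmorphism R -> R[i]} := real_complex R.
have [lambda] : exists lambda, eigenvalue (map_mx f B) lambda.
  have [|lambda] := @closed_rootP _ (char_poly (map_mx f B)) _.
    by rewrite size_char_poly; case: (\rank _) rZ.
  by rewrite -eigenvalue_root_char; exists lambda.
move=> /eigenvalueP[u uB u0]; exists lambda, (u *m map_mx f V).
have VS j : j \in S -> col j V = 0.
  move=> jS; rewrite VE; apply/colP => a; rewrite !mxE big1// => s _.
  by rewrite mxE zS ?mulr0.
have VG j : j \notin G -> V *m (row j W)^T = col j (B *m V).
  move=> jG; rewrite -BE VE -mulmxA; apply/colP => a.
  rewrite !mxE; apply: eq_bigr => s _; congr (_ * _).
  rewrite !mxE zG// mxE; apply: eq_bigr => l _.
  by rewrite !mxE mulrC.
split.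
- apply: contra u0 => /eqP uV; apply/eqP.
  have Vf : row_free (map_mx f V) by rewrite /row_free mxrank_map.
  by apply: (row_free_inj Vf); rewrite uV mul0mx.
- move=> j jS; rewrite mxE big1// => a _.
  by have /colP/(_ a) := VS j jS; rewrite !mxE => ->; rewrite /f rmorph0 mulr0.
- move=> j jG; have /(congr1 (mulmx u \o map_mx f))/= := VG j jG.
  rewrite map_mxM map_col map_mxM colE !mulmxA uB -colE -scalemxAl.
  move=> /matrixP/(_ 0 0); rewrite [LHS]mxE [RHS]mxE [RHS]mxE => <-.
  apply: eq_bigr => l _.
  by rewrite [map_mx _ _ _ _]mxE [_^T _ _]mxE [row _ _ _ _]mxE mulrC.
Qed.

(** * Eigenvectors of matrices with algebraically independent entries *)

(** An approximate eigenvector [v] of a sparse matrix: the entries [y] of the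
matrix are placed by [e], and the eigenvalue equation holds on the rows in [J],
each of which has an entry at a column in the support [T] of [v].  This entry
is then the pivot that the equation of the row expresses through [lambda], the
ratios [v l / v l0] and the entries which are not pivots; these are
[1 + (#|T| - 1) + (N - #|J|)] quantities, fewer than [N]. *)
Lemma eigen_alg_dependent (K : numFieldType) (N n : nat) (y : 'I_N -> K)
    (e : 'I_n -> 'I_n -> option 'I_N) (J : {set 'I_n}) (lambda : K)
    (v : 'I_n -> K) (T := [set l | v l != 0]) :
  (forall j l j' l' a, e j l = Some a -> e j' l' = Some a ->
    j = j' /\ l = l') ->
  (forall j, j \in J -> exists2 l, l \in T & isSome (e j l)) ->
  (forall j, j \in J -> \sum_l oapp y 0 (e j l) * v l = lambda * v j) ->
  (0 < #|T|)%N -> (#|T| < #|J|)%N ->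
  alg_dependent y.
Proof.
move=> e_inj J_adj J_eigen T0 TJ.
have [l0 l0T] : exists l0, l0 \in T by apply/card_gt0P.
have [j0 j0J] : exists j0, j0 \in J by apply/card_gt0P; exact: leq_ltn_trans TJ.
(* column and index of the pivot of each row *)
have /choice[pq pqP] : forall j, exists pq : 'I_n * 'I_N,
    j \in J -> pq.1 \in T /\ e j pq.1 = Some pq.2.
  have wit j : j \in J -> exists pq : 'I_n * 'I_N,
      pq.1 \in T /\ e j pq.1 = Some pq.2.
    move=> /J_adj[l lT]; case ejl: (e j l) => [a|//] _.
    by exists (l, a).
  move=> j; have [jJ|_] := boolP (j \in J).
    by have [pq ?] := wit j jJ; exists pq.
  by have [pq _] := wit j0 j0J; exists pq.
pose p j := (pq j).1; pose q j := (pq j).2.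
have pT j : j \in J -> p j \in T by move=> /pqP[].
have epq j : j \in J -> e j (p j) = Some (q j) by move=> /pqP[].
pose u l := v l / v l0.
have vl0 : v l0 != 0 by rewrite inE in l0T.
have u_eigen j : j \in J -> \sum_l oapp y 0 (e j l) * u l = lambda * u j.
  move=> jJ; rewrite /u mulrA -J_eigen// mulr_suml.
  by apply: eq_bigr => l _; rewrite mulrA.
pose t := lambda :: [seq u l | l <- enum (T :\ l0)]
            ++ [seq y a | a <- enum (~: (q @: J))].
have size_t : (size t < N)%N.
  have q_inj : {in J &, injective q}.
    move=> j j' jJ j'J qjj'; have := epq j' j'J; rewrite -qjj' => ej'.
    by have [] := e_inj _ _ _ _ _ (epq j jJ) ej'.
  have := cardsC (q @: J); rewrite card_ord card_in_imset// => NE.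
  rewrite /= size_cat !size_map -!cardE -[ltnRHS]NE -addSn ltn_add2r.
  by have := cardsD1 l0 T; rewrite l0T add1n => <-.
have ut l : poly_in t 2 (u l).
  have [->|ll0] := eqVneq l l0.
    by rewrite /u divff//; exact: poly_in1.
  have [lT|lT] := boolP (l \in T).
    apply: poly_in_mem => //; rewrite inE mem_cat map_f ?orbT//.
    by rewrite mem_enum !inE ll0; rewrite inE in lT.
  by move: lT; rewrite inE negbK /u => /eqP->; rewrite mul0r; exact: poly_in0.
have yt a : a \notin q @: J -> poly_in t 2 (y a).
  move=> aqJ; apply: poly_in_mem => //; rewrite inE mem_cat.
  by rewrite (map_f y) ?orbT// mem_enum inE.
have lambdat : poly_in t 2 lambda by apply: poly_in_mem; rewrite // inE eqxx.
clearbody t.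
apply: (@alg_dependent_rational _ _ _ t (\prod_(l <- enum T) u l)) => //.
- rewrite prodf_seq_neq0; apply/allP => l; rewrite mem_enum inE /= => vl.
  by rewrite mulf_neq0// invr_eq0.
- by eexists; exact: poly_in_prod.
move=> a; have [/imsetP[j jJ ->]|aqJ] := boolP (a \in q @: J); last first.
  by eexists; apply: poly_in_mul; [exact: poly_in_prod|exact: yt aqJ].
rewrite big_enum/= (bigD1 (p j)) ?pT//= mulrC mulrA -big_filter.
eexists; apply: poly_in_mul; last exact: poly_in_prod.
(* the factor of the denominator at the pivot column clears the division *)
have -> : y (q j) * u (p j) =
    lambda * u j - \sum_(l | l != p j) oapp y 0 (e j l) * u l.
  by rewrite -u_eigen// (bigD1 (p j))//= epq//= addrK.
apply: (@poly_in_add _ _ (2 + 2)).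
  exact: poly_in_mul.
apply/poly_in_opp/poly_in_sum => l lpj; apply: poly_in_mul => //.
case ejl : (e j l) => [b|] /=; last exact: poly_in0.
apply: yt; apply: contra lpj => /imsetP[j' j'J bE]; apply/eqP.
rewrite bE in ejl.
by have [<- ->] := e_inj _ _ _ _ _ (epq j' j'J) ejl.
Qed.

(** * Boundaries in the platoon graph *)

Lemma platoon_adjP n k (i j : 'I_n) :
  platoon_adj k i j = (i != j) && (i <= j + k)%N && (j <= i + k)%N.
Proof.
rewrite /platoon_adj; have -> : (i != j) = (i != j :> nat) by [].
lia.
Qed.

(** The vertex [u] of [T] closest to [i], on the side of [t], is at distance
more than [k] from [i], so the [k] vertices next to [u] on the way to [i] exist,
are neighbors of [u] and lie outside [T].  They are the interval starting at
[m] below. *)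
Lemma card_boundary n k (T : {set 'I_n}) (i t : 'I_n) :
  t \in T -> i \notin T -> [disjoint T & neighbors k i] ->
  exists B : {set 'I_n}, [/\ #|B| = k, [disjoint T & B] &
    forall j, j \in B -> exists2 l, l \in T & platoon_adj k j l].
Proof.
move=> tT iT TN.
have far l : l \in T -> (i + k < l)%N || (l + k < i)%N.
  move=> lT; have := disjointFr TN lT; rewrite inE platoon_adjP.
  have : i != l by apply: contraNneq iT => ->.
  have -> : (i != l) = (i != l :> nat) by [].
  lia.
suff [m [u [uT mk Tm]]] : exists (m : nat) (u : 'I_n), [/\ u \in T,
    (u - k = m /\ m + k = u)%N \/ (m = u.+1 /\ m + k <= n)%N &
    forall l : 'I_n, (m <= l < m + k)%N -> l \notin T].
  have mn (x : 'I_k) : (m + x < n)%N.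
    by case: mk => -[? ?]; have := ltn_ord x; have := ltn_ord u; lia.
  exists [set Ordinal (mn x) | x : 'I_k]; split.
  - rewrite card_imset ?card_ord// => x y /(congr1 val)/= /addnI xy.
    exact: val_inj.
  - rewrite disjoint_sym disjoint_subset.
    apply/fintype.subsetP => j /imsetP[x _ ->].
    by rewrite inE; apply: Tm; rewrite /= leq_addr ltn_add2l ltn_ord.
  - move=> j /imsetP[x _ ->]; exists u => //; rewrite platoon_adjP.
    have -> : (Ordinal (mn x) != u) = (m + x != u)%N by [].
    by have /= := ltn_ord x; lia.
have /orP[it|ti] := far _ tT.
  case: (@arg_minnP _ t (fun l => (l \in T) && (i < l)%N) val) => [|u].
    by rewrite tT; lia.
  move=> /andP[uT iu] umin; exists (u - k)%N, u; split => //.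
    by left; have := far _ uT; lia.
  move=> l lu; apply/negP => lT.
  have := umin l; rewrite lT /=; have := far _ uT; have := far _ lT.
  lia.
case: (@arg_maxnP _ t (fun l => (l \in T) && (l < i)%N) val) => [|u].
  by rewrite tT; lia.
move=> /andP[uT iu] umax; exists u.+1, u; split => //.
  by right; have := far _ uT; have := ltn_ord i; lia.
move=> l lu; apply/negP => lT.
have := umax l; rewrite lT /=; have := far _ uT; have := far _ lT.
lia.
Qed.

(** * Recovery of the initial values *)

Local Open Scope classical_set_scope.

Theorem theorem2 (R : realType) (n k : nat) (hk : (1 <= k)%N) (hn : (k <= n)%N) :
  {ae lebesgue_tuple #|{: weight_index n k}|,
    forall w : #|{: weight_index n k}|.-tuple (measurableTypeR R),
      (forall e : weight_index n k, 0 < weight w e) ->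
      forall i : 'I_n,
        determines_initial_values (weight_mx w) (output_mx R k i)
          ((k - 1) %/ 2)}.
Proof.
apply: filterS (@ae_alg_independent R _) => w w_indep _ i.
move=> x x' F F' phi phi' hF hF' hC.
apply: contrapT => xx'; apply: w_indep.
pose W := weight_mx w; pose S := i |: neighbors k i; pose G := F :|: F'.
pose z t := state W x phi t - state W x' phi' t.
have subE (y y' : 'cV[R]_n) j : (y - y') j 0 = y j 0 - y' j 0.
  by rewrite !mxE.
have [||| lambda [v [v0 vS vG]]] := @invariant_direction R n W z S G.
- by rewrite subr_eq0; apply/eqP.
- by move=> t j jS; rewrite subE (output_mx_eq (hC t) jS) subrr.
- move=> t j; rewrite finset.in_setU negb_or => /andP[jF jF'].
  by rewrite /z mulmxBr !subE !state_nonfaulty.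
pose T : {set 'I_n} := [set l | v 0 l != 0]%SET.
have [l lT] : exists l, l \in T.
  by have /rV0Pn[l vl] := v0; exists l; rewrite inE.
have TS l' : l' \in S -> l' \notin T by move=> /vS; rewrite inE negbK => ->.
have [||B [cardB TB Badj]] := @card_boundary n k T i l lT.
- by apply: TS; exact: setU11.
- by rewrite disjoint_sym disjoint_subset; apply/fintype.subsetP => j jN;
    rewrite inE TS// setU1r.
pose J := (T :|: B) :\: G.
pose e j l : option 'I_#|{: weight_index n k}| :=
  omap enum_rank (insub (j, l) : option (weight_index n k)).
have WE j l' : real_complex R (W j l') =
    oapp (fun a => real_complex R (tnth w a)) 0 (e j l').
  by rewrite mxE /e; case: insub => [a|]; rewrite /= ?rmorph0.
apply: (@alg_dependent_rmorph _ _ (real_complex R)).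
apply: (@eigen_alg_dependent _ _ _ _ e J lambda (v 0)).
- move=> j1 l1 j2 l2 a; rewrite /e.
  case: insubP => // a1 _ a1E [<-].
  case: insubP => // a2 _ a2E [/enum_rank_inj a21].
  by move: a2E; rewrite a21 a1E => -[-> ->].
- move=> j; rewrite finset.in_setD => /andP[_].
  move=> /finset.setUP[jT|/Badj[l' l'T jl']].
    by exists j => //; rewrite /e insubT//= eqxx.
  by exists l' => //; rewrite /e insubT//= inE jl' orbT.
- move=> j; rewrite finset.in_setD => /andP[jG _]; rewrite -vG//.
  by apply: eq_bigr => l' _; rewrite WE.
- by apply/card_gt0P; exists l.
have cardG : (#|G| < k)%N.
  have FF' : (#|G| <= #|F| + #|F'|)%N := leq_card_setU F F'.
  apply: leq_ltn_trans (leq_trans FF' (leq_add hF hF')) _.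
  by lia.
have : (#|T :|: B| <= #|J| + #|G|)%N.
  rewrite -(cardsID G (T :|: B)) addnC leq_add2l.
  by apply: subset_leq_card; exact: subsetIr.
rewrite cardsU (finset.disjoint_setI0 TB) cards0 subn0 cardB => TJ.
by rewrite -(ltn_add2r #|G|); apply: leq_trans TJ; rewrite ltn_add2l.
Qed.
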